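(* Let $H$ be a separable infinite-dimensional complex Hilbert space, let $k\in\mathbb N$, let $\mathcal T=(T_1,\dots,T_k)\in B(H)^k$, and let $B\subset(\mathbb N\times\mathbb N)\setminus\Delta$ be an admissible set. Then there exists an orthonormal basis $(u_n)_{n=1}^\infty$ of $H$ such that $$\langle \mathcal T u_j,u_n\rangle=0\qquad\text{for all }(n,j)\in B.$$
   Context: $B(H)$ is the space of bounded linear operators on $H$; $\mathbb N=\{1,2,\dots\}$. For $\mathcal T=(T_1,\dots,T_k)\in B(H)^k$ and $x,y\in H$, $\langle\mathcal Tx,y\rangle=(\langle T_1x,y\rangle,\dots,\langle T_kx,y\rangle)\in\mathbb C^k$, and $0$ also denotes the zero vector of $\mathbb C^k$. $\Delta=\{(n,n):n\in\mathbb N\}$. A set $B\subset(\mathbb N\times\mathbb N)\setminus\Delta$ is called admissible if for every $m\in\mathbb N$ there exists $n\in\mathbb N$, $n>m$, such that $(j,n)\notin B$ and $(n,j)\notin B$ for all $j=1,\dots,m$. *)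

(* Defs.v *)
From HB Require Import structures.
From mathcomp Require Import all_boot all_order all_algebra.
From mathcomp Require Import sesquilinear.
From mathcomp Require Export complex.
From mathcomp Require Import all_classical all_reals all_analysis.

Set Implicit Arguments.
Unset Strict Implicit.
Unset Printing Implicit Defensive.

Import Order.TTheory GRing.Theory Num.Theory.
Import numFieldNormedType.Exports.

Local Open Scope classical_set_scope.
Local Open Scope ring_scope.
Local Open Scope complex_scope.

(* The inner product is linear in its first argument and conjugate-linear in
   the second one (this is what {dot V for Num.conj} says), and it induces the
   norm of V, hence also its topology. *)
HB.mixin Record CompleteNormedModule_isHilbert (R : realType) V
    & CompleteNormedModule R[i] V := {
  inner : {dot V for @Num.conj R[i]} ;
  inner_normE : forall x : V, inner x x = `|x| ^+ 2
}.

#[short(type="hilbertType")]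
HB.structure Definition Hilbert (R : realType) :=
  { V of CompleteNormedModule R[i] V & CompleteNormedModule_isHilbert R V }.

Definition separable (T : topologicalType) :=
  exists2 D : set T, countable D & dense D.

Definition finite_dim (K : fieldType) (V : lmodType K) :=
  exists n (e : 'I_n -> V), forall x : V,
    exists c : 'I_n -> K, x = \sum_(i < n) c i *: e i.

Definition bounded_operator (K : numFieldType) (V : normedModType K)
    (T : {linear V -> V}) :=
  exists M : K, forall x : V, `|T x| <= M * `|x|.

Section Hilbert_defs.
Context (R : realType) (H : hilbertType R).

(* An orthonormal sequence is an orthonormal basis when its finite linear
   combinations are dense, i.e. its closed linear span is H. *)
Definition orthonormal_basis (u : nat -> H) :=
  (forall i j, inner (u i) (u j) = (i == j)%:R) /\
  dense [set x : H | exists n (c : 'I_n -> R[i]), x = \sum_(i < n) c i *: u i].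

Definition tuple_inner (k : nat) (T : 'I_k -> {linear H -> H}) (x y : H)
    : 'rV[R[i]]_k :=
  \row_(l < k) inner (T l x) y.

End Hilbert_defs.

(* The positive integers are represented by nat through the order isomorphism
   n |-> n - 1; with this shift the condition "n > m and j = 1, ..., m" reads
   "n > m and j <= m" with j, m, n ranging over all of nat. *)
Definition off_diagonal (B : set (nat * nat)) := forall n, ~ B (n, n).

Definition admissible (B : set (nat * nat)) :=
  forall m : nat, exists2 n : nat, (m < n)%N &
    forall j : nat, (j <= m)%N -> ~ B (j, n) /\ ~ B (n, j).

(* Main.v *)
Require Import Defs.
From HB Require Import structures.
From mathcomp Require Import all_boot all_order all_algebra.
From mathcomp Require Import sesquilinear complex.
From mathcomp Require Import all_classical all_reals all_analysis.

(* Only finitely many linear functionals are involved in keeping a new vector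
   orthogonal to finitely many u_j, T_l u_j and T_l^* u_j, and in infinite
   dimension they have a common nonzero zero. Hence the vectors u_n can be
   chosen one at a time, in any order, meeting all the constraints. Density of
   the span is obtained at free indices: once u_0, ..., u_m are known, take n > m
   unrelated by B to every j <= m, let u_n be the normalized residual of the next
   element of a dense sequence modulo span(u_0, ..., u_m), and only then fill in
   u_(m+1), ..., u_(n-1), whose constraints against u_n can still be met. *)

Set Implicit Arguments.
Unset Strict Implicit.
Unset Printing Implicit Defensive.

Import Order.TTheory GRing.Theory Num.Theory.
Import numFieldNormedType.Exports.

Local Open Scope classical_set_scope.
Local Open Scope ring_scope.

(* Contrapositive form of: finitely many functionals cut an infinite-dimensional
   space down to an infinite-dimensional one. *)
Lemma finite_codim_span (K : fieldType) (V : lmodType K) (I : eqType)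
    (f : I -> V -> K) (f_lin : forall i, scalar (f i)) (s : seq I)
    (n : nat) (e : 'I_n -> V) :
  (forall x, (forall i, i \in s -> f i x = 0) ->
    exists c : 'I_n -> K, x = \sum_(i < n) c i *: e i) ->
  finite_dim V.
Proof.
elim: s n e => [|i s IHs] n e span_e.
  by exists n, e => x; apply: span_e.
(* Either some [v] in the common kernel of [s] has [f i v != 0], and adjoining [v] to the spanning
   family makes up for dropping [f i]; or [f i] vanishes on that kernel and imposes nothing new. *)
have [[v [sv fv0]]|fi0] :=
    pselect (exists v, (forall j, j \in s -> f j v = 0) /\ f i v != 0); last first.
  apply: (IHs n e) => x sx; apply: span_e => j.
  rewrite inE => /predU1P[->|]; last exact: sx.
  by apply/eqP/negPn/negP => fix0; apply: fi0; exists x.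
pose e' (j : 'I_n.+1) := if unlift ord0 j is Some j' then e j' else v.
apply: (IHs n.+1 e') => x sx.
have [j|c def_x] := span_e ((- (f i x / f i v)) *: v + x).
  rewrite f_lin inE => /predU1P[->|js]; first by rewrite mulNr divfK // addNr.
  by rewrite (sv j) ?(sx j) ?mulr0 ?addr0.
exists (fun j => if unlift ord0 j is Some j' then c j' else f i x / f i v).
rewrite big_ord_recl /e' unlift_none; under eq_bigr do rewrite liftK.
by rewrite -def_x scaleNr addNKr.
Qed.

(** Otherwise the common kernel is zero, hence spanned by the empty family, and [finite_codim_span]
    makes the whole space finite-dimensional. *)
Lemma common_zero (K : fieldType) (V : lmodType K) (I : eqType)
    (f : I -> V -> K) (s : seq I) :
  (forall i, scalar (f i)) -> ~ finite_dim V ->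
  exists2 v, v != 0 & forall i, i \in s -> f i v = 0.
Proof.
move=> f_lin Vinf; apply: contrapT => no_v; apply: Vinf.
apply: (finite_codim_span f_lin (s := s) (e := fun i : 'I_0 => 0)) => x sx.
exists (fun=> 0); rewrite big_ord0; apply: contrapT => /eqP x0.
by apply: no_v; exists x.
Qed.

Lemma dense_sequence (T : topologicalType) :
  separable T -> T -> exists x : nat -> T, dense (range x).
Proof.
move=> [D /countable_injP[g g_inj] D_dense] t0.
(* [x n] is the point of [D] with code [n]; codes that are not taken get the default [t0]. *)
have [x xP] : {x : nat -> T & forall n, D `&` [set t | g t = n] !=set0 ->
    (D `&` [set t | g t = n]) (x n)}.
  apply: (@choice _ _ (fun n y => D `&` [set t | g t = n] !=set0 ->
    (D `&` [set t | g t = n]) y)) => n.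
  by have [[y Dy]|none] := pselect (D `&` [set t | g t = n] !=set0);
    [exists y|exists t0].
exists x => O O0 Oopen; have [t [Ot Dt]] := D_dense O O0 Oopen.
exists t; split=> //; exists (g t) => //.
have [|Dx gx] := xP (g t); first by exists t.
by apply: g_inj; rewrite ?inE.
Qed.

Definition update (T : Type) (u : nat -> T) n v i := if i == n then v else u i.

Definition in_span (K : fieldType) (V : lmodType K) (D : seq nat)
    (u : nat -> V) (x : V) :=
  exists c : nat -> K, x = \sum_(i <- D) c i *: u i.

(** Coefficients are extended by zero; duplicate-freeness makes [E] filtered by [D] a permutation of
    [D]. *)
Lemma in_span_sub (K : fieldType) (V : lmodType K) (D E : seq nat)
    (u w : nat -> V) (x : V) :
  uniq D -> uniq E -> {subset D <= E} -> {in D, u =1 w} ->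
  in_span D u x -> in_span E w x.
Proof.
move=> uD uE DE uw [c ->]; exists (fun i => if i \in D then c i else 0).
rewrite (eq_big_seq (fun i => c i *: w i)); last by move=> i /uw ->.
rewrite [RHS](eq_bigr (fun i => if i \in D then c i *: w i else 0)); last first.
  by move=> i _; case: ifP => // _; rewrite scale0r.
rewrite -big_mkcond -[RHS]big_filter; apply: perm_big; apply: uniq_perm => //.
  exact: filter_uniq.
by move=> i; rewrite mem_filter; case: (boolP (i \in D)) => [/DE|].
Qed.

Section PartialBases.
Context (R : realType) (H : hilbertType R) (k : nat).
Context (T : 'I_k -> {linear H -> H}) (B : set (nat * nat)).

Lemma innerC (x y : H) : inner x y = (inner y x)^*%C.
Proof. by rewrite hermC expr0 mul1r. Qed.

Lemma inner_eq0C (x y : H) : inner x y = 0 -> inner y x = 0.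
Proof. by rewrite innerC => /eqP; rewrite conjc_eq0 => /eqP. Qed.

Lemma inner_scalar (y : H) : scalar (fun x => inner x y).
Proof. by move=> a x z; rewrite linearPl. Qed.

Lemma innerZl (a : R[i]) (x y : H) : inner (a *: x) y = a * inner x y.
Proof. by rewrite linearZl_LR. Qed.

Lemma inner_normalize (x : H) : x != 0 ->
  inner (`|x|^-1 *: x) (`|x|^-1 *: x) = 1.
Proof. by move=> x0; rewrite inner_normE normfZV // expr1n. Qed.

(* [D] lists the indices where [u] is already chosen; its values elsewhere are junk. *)
Definition partial_basis (D : seq nat) (u : nat -> H) :=
  forall i j, i \in D -> j \in D -> inner (u i) (u j) = (i == j)%:R /\
    (B (i, j) -> forall l, inner (T l (u j)) (u i) = 0).

Lemma partial_basis_sub (D E : seq nat) (u : nat -> H) :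
  {subset D <= E} -> partial_basis E u -> partial_basis D u.
Proof. by move=> DE Eu i j /DE iE /DE jE; apply: Eu. Qed.

(** The conditions involving [T] are asked only at pairs in [B], so that they become vacuous when
    [n] is a free index. *)
Lemma partial_basis_cons (Boff : off_diagonal B) (D : seq nat) (u : nat -> H)
    (n : nat) (v : H) :
  n \notin D -> partial_basis D u -> inner v v = 1 ->
  (forall i, i \in D -> inner v (u i) = 0) ->
  (forall i, i \in D -> B (n, i) -> forall l, inner (T l (u i)) v = 0) ->
  (forall i, i \in D -> B (i, n) -> forall l, inner (T l v) (u i) = 0) ->
  partial_basis (n :: D) (update u n v).
Proof.
move=> nD Du v1 vu Tuv Tvu i j; rewrite /update !inE.
have [->|in_ /=] := eqVneq i n; have [->|jn /=] := eqVneq j n => //= iD jD.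
- by split=> // /Boff.
- by split; [rewrite vu // eq_sym (negbTE jn) | exact: Tuv].
- by split; [rewrite (inner_eq0C (vu _ iD)) (negbTE in_) | exact: Tvu].
- exact: Du.
Qed.

Lemma generic_vector (Hinf : ~ finite_dim H) (D : seq nat) (u : nat -> H) :
  exists2 v, inner v v = 1 & forall i, i \in D -> inner v (u i) = 0 /\
    forall l, inner (T l (u i)) v = 0 /\ inner (T l v) (u i) = 0.
Proof.
(* [inner (T l (u i)) v] is conjugate-linear in [v], so its conjugate is used instead;
   [inner (T l v) (u i)] is the pairing of [v] with the adjoint of [T l] at [u i]. *)
pose f (p : nat * option (bool * 'I_k)) v := match p with
  | (i, None) => inner v (u i)
  | (i, Some (true, l)) => inner v (T l (u i))
  | (i, Some (false, l)) => inner (T l v) (u i)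
  end.
have f_lin p : scalar (f p).
  case: p => i [[[] l]|]; try exact: inner_scalar.
  by move=> a x y; rewrite /f linearP inner_scalar.
have [v v0 fv] := @common_zero _ _ _ f
  [seq (i, o) | i <- D, o <- enum {: option (bool * 'I_k)}] f_lin Hinf.
have fvD i o : i \in D -> f (i, o) (`|v|^-1 *: v) = 0.
  move=> iD; have := f_lin (i, o) `|v|^-1 v 0; rewrite !addr0 => ->.
  have f0 : f (i, o) 0 = 0.
    by have := f_lin (i, o) (-1) 0 0; rewrite scaler0 addr0 mulN1r addNr.
  by rewrite f0 addr0 fv ?mulr0 // allpairs_f // mem_enum.
exists (`|v|^-1 *: v); first exact: inner_normalize.
move=> i iD; split; first exact: (fvD i None).
move=> l; split; last exact: (fvD i (Some (false, l))).
by apply: inner_eq0C; exact: (fvD i (Some (true, l))).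
Qed.

(** [v] is the normalized residual of [x] after projection onto the span of the [u i], or any unit
    vector orthogonal to them if the residual is zero. Nothing is said about [T], hence the recourse
    to free indices. *)
Lemma spanning_vector (Hinf : ~ finite_dim H) (D : seq nat) (u : nat -> H)
    (x : H) :
  uniq D -> partial_basis D u ->
  exists v, [/\ inner v v = 1, forall i, i \in D -> inner v (u i) = 0 &
    exists a, exists c : nat -> R[i], x = a *: v + \sum_(i <- D) c i *: u i].
Proof.
move=> uD Du; pose p := \sum_(i <- D) inner x (u i) *: u i.
have [xp|xp] := eqVneq (x - p) 0.
  have [v v1 vD] := generic_vector Hinf D u.
  exists v; split=> //; first by move=> i /vD[].
  exists 0, (fun i => inner x (u i)); rewrite scale0r add0r.
  by apply/eqP; rewrite -subr_eq0 -/p xp.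
exists (`|x - p|^-1 *: (x - p)); split; first exact: inner_normalize.
  move=> i iD; rewrite innerZl linearBl; apply/eqP; rewrite mulf_eq0; apply/orP; right.
  rewrite /p linear_sumlz (bigD1_seq i) //=.
  rewrite big_seq_cond big1 ?addr0.
    by rewrite innerZl (Du i i iD iD).1 eqxx /= mulr1 subrr.
  move=> j /andP[jD ji]; rewrite innerZl (Du j i jD iD).1.
  by rewrite (negbTE ji) mulr0.
exists `|x - p|, (fun i => inner x (u i)).
by rewrite scalerA divff ?normr_eq0 // scale1r subrK.
Qed.

(** Indices of [E] already in [D] are skipped, so [E] may be a whole initial segment whose gaps are
    to be filled. *)
Lemma partial_basis_extend (Hinf : ~ finite_dim H) (Boff : off_diagonal B)
    (E D : seq nat) (u : nat -> H) :
  partial_basis D u ->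
  exists2 w, {in D, u =1 w} & partial_basis (E ++ D) w.
Proof.
elim: E => [|n E IHE] in D u * => Du; first by exists u.
have [nD|nD] := boolP (n \in D).
  have [w uw EDw] := IHE D u Du; exists w => //.
  apply: partial_basis_sub EDw => i; rewrite inE => /predU1P[->|//].
  by rewrite mem_cat nD orbT.
have [v v1 vD] := generic_vector Hinf D u.
have [|w uw EDw] := IHE (n :: D) (update u n v).
  by apply: partial_basis_cons => // i /vD[] // _ Tv _ l; have [] := Tv l.
exists w.
  move=> i iD; rewrite -uw ?inE ?iD ?orbT // /update.
  by case: eqP => // ni; rewrite -ni iD in nD.
by apply: partial_basis_sub EDw => i; rewrite /= !(inE, mem_cat) orbCA.
Qed.

Lemma partial_basis_step (Hinf : ~ finite_dim H) (Boff : off_diagonal B)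
    (Badm : admissible B) (m : nat) (u : nat -> H) (x : H) :
  partial_basis (iota 0 m.+1) u ->
  exists n w, [/\ (m < n)%N, forall i, (i <= m)%N -> w i = u i,
    partial_basis (iota 0 n.+1) w & in_span (iota 0 n.+1) w x].
Proof.
move=> mu; have [n mn freen] := Badm m.
have mem_m i : (i \in iota 0 m.+1) = (i <= m)%N by rewrite mem_iota ltnS.
have mem_n i : (i \in iota 0 n.+1) = (i <= n)%N by rewrite mem_iota ltnS.
have nD : n \notin iota 0 m.+1 by rewrite mem_m -ltnNge.
have [v [v1 vu [a [c def_x]]]] := spanning_vector Hinf x (iota_uniq _ _) mu.
have u1 : partial_basis (n :: iota 0 m.+1) (update u n v).
  (* By the choice of [n], no pair of [n] with an index up to [m] lies in [B]. *)
  by apply: partial_basis_cons => // i; rewrite mem_m => /freen[].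
have upd i : i \in iota 0 m.+1 -> update u n v i = u i.
  by rewrite /update; case: eqP => // ->; rewrite (negbTE nD).
have [w uw nw] := partial_basis_extend Hinf Boff (iota 0 n.+1) u1.
exists n, w; split=> //.
- by move=> i; rewrite -mem_m => im; rewrite -uw ?upd // in_cons im orbT.
- by apply: partial_basis_sub nw => i; rewrite mem_cat => ->.
apply: (@in_span_sub _ _ (n :: iota 0 m.+1) _ (update u n v)) => //.
- by rewrite cons_uniq nD iota_uniq.
- exact: iota_uniq.
- move=> i; rewrite in_cons mem_n mem_m.
  by case/predU1P => [->//|im]; apply: leq_trans im (ltnW mn).
exists (update c n a); rewrite big_cons /update eqxx def_x; congr (_ + _).
by apply: eq_big_seq => i iD; case: eqP => // ni; rewrite -ni iD in nD.
Qed.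

End PartialBases.

Theorem theorem1p2 (R : realType) (H : hilbertType R)
    (Hsep : separable H) (Hinf : ~ finite_dim H)
    (k : nat) (k_gt0 : (0 < k)%N)
    (T : 'I_k -> {linear H -> H}) (Tbnd : forall l : 'I_k, bounded_operator (T l))
    (B : set (nat * nat)) (Boff : off_diagonal B) (Badm : admissible B) :
  exists u : nat -> H,
    orthonormal_basis u /\
    (forall n j : nat, B (n, j) -> tuple_inner T (u j) (u n) = 0).
Proof.
have [x x_dense] := dense_sequence Hsep 0.
pose state := {p : nat * (nat -> H) | partial_basis T B (iota 0 p.1.+1) p.2}.
have [u0 _ Du0] := @partial_basis_extend R H k T B Hinf Boff
  [:: 0%N] [::] (fun=> 0) (fun i j iD => False_ind _ (notF iD)).
pose s0 : state := exist _ (0%N, u0) Du0.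
(* The stage number is passed along with the state because it selects the dense-sequence element to
   be captured. *)
have [next nextP] : {next : nat * state -> state & forall q,
    let p := sval q.2 in let p' := sval (next q) in
    [/\ (p.1 < p'.1)%N, forall i, (i <= p.1)%N -> p'.2 i = p.2 i &
      in_span (iota 0 p'.1.+1) p'.2 (x q.1)]}.
  apply: (@choice _ _ (fun (q : nat * state) (q' : state) =>
    let p := sval q.2 in let p' := sval q' in
    [/\ (p.1 < p'.1)%N, forall i, (i <= p.1)%N -> p'.2 i = p.2 i &
      in_span (iota 0 p'.1.+1) p'.2 (x q.1)])) => -[i [[m u] mu]].
  have [n [w [mn uw nw xw]]] :=
    partial_basis_step Hinf Boff Badm (x i) mu.
  by exists (exist _ (n, w) nw).
pose st := fix st i : state := if i is j.+1 then next (j, st j) else s0.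
pose len i := (sval (st i)).1; pose vec i := (sval (st i)).2.
have len_lt i : (len i < len i.+1)%N by have [] := nextP (i, st i).
have vecS i j : (j <= len i)%N -> vec i.+1 j = vec i j.
  by have [_ + _] := nextP (i, st i); apply.
have len_ge i : (i <= len i)%N.
  by elim: i => // i IHi; apply: leq_ltn_trans IHi (len_lt i).
have vec_le i d j : (j <= len i)%N ->
    (j <= len (d + i)%N)%N /\ vec (d + i)%N j = vec i j.
  move=> ji; elim: d => [//|d [jd IHd]].
  by rewrite addSn vecS // IHd (leq_trans jd (ltnW (len_lt _))).
(* Stage [i] has already fixed index [i], since [i <= len i], and later stages keep it: the diagonal
   is the limit sequence. *)
pose u i := vec i i.
have uE i j : (j <= len i)%N -> u j = vec i j.
  move=> ji; rewrite /u; have [ij|/ltnW ij] := leqP i j.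
    by have [_] := vec_le i (j - i)%N j ji; rewrite subnK.
  by have [_] := vec_le j (i - j)%N j (len_ge j); rewrite subnK.
have u_basis i j : inner (u i) (u j) = (i == j)%:R /\
    (B (i, j) -> forall l, inner (T l (u j)) (u i) = 0).
  (* Both indices are settled at stage [maxn i j], whose invariant gives the claim. *)
  have im : (i <= len (maxn i j))%N by rewrite (leq_trans (leq_maxl i j)).
  have jm : (j <= len (maxn i j))%N by rewrite (leq_trans (leq_maxr i j)).
  rewrite (uE _ _ im) (uE _ _ jm).
  by apply: (svalP (st (maxn i j))); rewrite mem_iota ltnS.
exists u; split; last first.
  by move=> n j Bnj; apply/rowP => l; rewrite !mxE (u_basis n j).2.
split=> [i j|]; first by have [] := u_basis i j.
(* Each [x i] lies in the span from stage [i.+1] on, so the span contains a dense set. *)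
move=> O O0 Oopen; have [y [Oy [i _ xiy]]] := x_dense O O0 Oopen.
exists (x i); split; first by rewrite xiy.
have [_ _ [c xi]] := nextP (i, st i).
exists (len i.+1).+1, c; rewrite xi -[in LHS](subn0 (len i.+1).+1) -/(index_iota 0 _).
rewrite -(big_mkord xpredT (fun j => c j *: u j)).
rewrite big_seq [RHS]big_seq; apply: eq_bigr => j.
by rewrite mem_index_iota => /andP[_ jm]; rewrite (uE i.+1).
Qed.
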